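(* Let $W \subset \mathrm{GL}(V)$ be the complexification of a finite real reflection group (so that $W$ is a finite Coxeter group and its reflection arrangement $\mathcal{A}$ is a complexified real reflection arrangement). Then the linear forms $\alpha_H \in V^*$ with kernel $H$ ($H \in \mathcal{A}$) can be chosen such that the linear map $\Phi : \mathbb{C}\mathcal{A} \to S^2V^*$, $\Phi(v_H) = \alpha_H^2$, is a morphism of $W$-modules.
   Context: $V = V_0 \otimes_{\mathbb{R}} \mathbb{C}$ for a finite-dimensional real vector space $V_0$, and $W$ is a finite subgroup of $\mathrm{GL}(V_0)$ generated by reflections, viewed in $\mathrm{GL}(V)$. $\mathcal{A}$ is the set of hyperplanes $\mathrm{Ker}(s-1) \subset V$ for $s$ a reflection of $W$, assumed essential ($\bigcap\mathcal{A} = \{0\}$). $\mathbb{C}\mathcal{A}$ is the complex vector space with basis $(v_H)_{H \in \mathcal{A}}$, with $W$-action $w.v_H = v_{w(H)}$; $W$ acts on $V^*$ by $(w.\gamma)(x) = \gamma(w^{-1}.x)$, and on $S^2V^*$ (quadratic forms on $V$) accordingly. *)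

(* Defs.v *)
From HB Require Import structures.
From mathcomp Require Import all_boot all_order all_algebra finmap.
From mathcomp Require Import boolp functions reals.
From mathcomp Require Import complex.

Set Implicit Arguments.
Unset Strict Implicit.
Unset Printing Implicit Defensive.

Import GRing.Theory.
Local Open Scope fset_scope.
Local Open Scope complex_scope.
Local Open Scope ring_scope.

(* The pair (x, y) stands for x (x) 1 + y (x) i in V0 (x)_R C. *)
Definition complexification (R : realType) (V0 : vectType R) : Type :=
  (V0 * V0)%type.

Section ComplexificationStructure.
Import VectorInternalTheory.
Variables (R : realType) (V0 : vectType R).
Local Notation V := (complexification V0).

HB.instance Definition _ := GRing.Zmodule.on V.

Definition complexification_scale (a : R[i]) (z : V) : V :=
  (Re a *: z.1 - Im a *: z.2, Re a *: z.2 + Im a *: z.1).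

Fact complexification_scaleA a b z :
  complexification_scale a (complexification_scale b z) =
  complexification_scale (a * b) z.
Proof.
case: a b z => [a1 a2] [b1 b2] [x y]; rewrite /complexification_scale /=.
rewrite !scalerDr !scalerDl !scalerN !scaleNr !scalerA !opprD.
congr pair; rewrite -!addrA; congr (_ + _); rewrite !addrA.
  by rewrite addrC addrA.
by rewrite addrC addrA.
Qed.

Fact complexification_scale1 : left_id 1 complexification_scale.
Proof.
by move=> [x y]; rewrite /complexification_scale /= !scale1r !scale0r subr0
  addr0.
Qed.

Fact complexification_scaleDr :
  right_distributive complexification_scale +%R.
Proof.
move=> a [x y] [x' y']; congr pair => /=.
  by rewrite !scalerDr opprD addrACA.
by rewrite !scalerDr addrACA.
Qed.

Fact complexification_scaleDl z :
  {morph complexification_scale^~ z : a b / a + b}.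
Proof.
case: z => [x y] [a1 a2] [b1 b2]; congr pair => /=.
  by rewrite !scalerDl opprD addrACA.
by rewrite !scalerDl addrACA.
Qed.

HB.instance Definition _ := GRing.Zmodule_isLmodule.Build R[i] V
  complexification_scaleA complexification_scale1
  complexification_scaleDr complexification_scaleDl.

Fact complexification_vect_iso : Vector.axiom (dim V0) V.
Proof.
exists (fun z : V => \row_j (v2r z.1 0 j +i* v2r z.2 0 j)).
  move=> [a1 a2] [x y] [x' y']; apply/rowP=> j; rewrite !mxE /=.
  by rewrite !linearD /= !linearN !linearZ /= !mxE mulrN.
exists (fun u : 'rV_(dim V0) =>
  (r2v (\row_j Re (u 0 j)), r2v (\row_j Im (u 0 j)))).
  move=> [x y] /=; congr pair; rewrite -[RHS]v2rK.
    by congr r2v; apply/rowP=> j; rewrite !mxE.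
  by congr r2v; apply/rowP=> j; rewrite !mxE.
by move=> u; apply/rowP=> j; rewrite !mxE /= !r2vK !mxE; case: (u 0 j).
Qed.

HB.instance Definition _ :=
  Lmodule_hasFinDim.Build R[i] V complexification_vect_iso.

Definition complexify (f : 'End(V0)) : 'End(V) :=
  linfun (fun z : V => (f z.1, f z.2) : V).

Lemma complexifyE f (z : V) : complexify f z = (f z.1, f z.2).
Proof.
pose g (z : V) : V := (f z.1, f z.2).
have g_lin : linear g.
  by move=> [a1 a2] [x y] [x' y']; congr pair;
    rewrite /= !linearD /= ?linearN !linearZ.
pose gM := GRing.isLinear.Build R[i] V V *:%R g g_lin.
pose gL : {linear V -> V} := HB.pack g gM.
exact: (lfunE gL z).
Qed.

End ComplexificationStructure.

Section ComplexifyTheory.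
Variables (R : realType) (V0 : vectType R).
Implicit Types f g : 'End(V0).

Lemma complexify_comp f g :
  complexify (f \o g)%VF = (complexify f \o complexify g)%VF.
Proof.
by apply/lfunP=> z; rewrite comp_lfunE !complexifyE /= !comp_lfunE.
Qed.

Lemma complexify_ker0 f : lker f == 0%VS -> lker (complexify f) == 0%VS.
Proof.
move/lker0P=> f_inj; apply/lker0P=> -[x y] [x' y'].
by rewrite !complexifyE /= => -[/f_inj-> /f_inj->].
Qed.

Lemma complexify_inv f : lker f == 0%VS ->
  complexify (f^-1)%VF = ((complexify f)^-1)%VF.
Proof.
move=> f0; have cf0 := complexify_ker0 f0.
apply/lfunP=> z; apply: (lker0P cf0); rewrite lker0_lfunVK //.
by rewrite !complexifyE /= !lker0_lfunVK //; case: z.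
Qed.

End ComplexifyTheory.

Lemma fixedSpace_conj (K : fieldType) (U : vectType K) (f s : 'End(U)) :
  lker f == 0%VS ->
  fixedSpace (f \o s \o f^-1)%VF = (f @: fixedSpace s)%VS.
Proof.
move=> f0; apply/vspaceP=> x; apply/fixedSpaceP/memv_imgP => [|[y]].
  rewrite !comp_lfunE /= => fx; exists (f^-1%VF x); last by rewrite lker0_lfunVK.
  by apply/fixedSpaceP; rewrite -{2}fx lker0_lfunK.
by move=> /fixedSpaceP sy ->; rewrite !comp_lfunE /= lker0_lfunK // sy.
Qed.

Record finGLgroup (K : fieldType) (U : vectType K) := FinGLGroup {
  elts :> {fset 'End(U)};
  finGLgroup_ker0 : {in elts, forall g, lker g == 0%VS};
  finGLgroup1 : \1%VF \in elts;
  finGLgroupM : {in elts &, forall g h, (g \o h)%VF \in elts};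
  finGLgroupV : {in elts, forall g, (g^-1)%VF \in elts}
}.

(* This is only used for elements of finite groups, so that the condition of
   finite order, which excludes transvections, is automatic. *)
Definition is_reflection (K : fieldType) (U : vectType K) (s : 'End(U)) : bool :=
  (lker s == 0%VS) && ((\dim (fixedSpace s)).+1 == \dim {:U}%VS).

(* The subgroup generated by the reflections of W lies in W, hence is finite:
   it is enough to quantify over the finite subgroups of GL(U). *)
Definition generated_by_reflections (K : fieldType) (U : vectType K)
    (W : finGLgroup U) : Prop :=
  forall G : finGLgroup U,
    {in elts W, forall s, is_reflection s -> s \in elts G} ->
    elts W `<=` elts G.

Section ReflectionArrangement.
Variables (R : realType) (V0 : vectType R) (W : finGLgroup V0).
Local Notation C := R[i].
Local Notation V := (complexification V0).

Definition arrangement : {fset {vspace V}} :=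
  [fset fixedSpace (complexify s) | s in elts W
                                  & is_reflection (complexify s)].

Definition essential : Prop := (\bigcap_(H : arrangement) val H)%VS = 0%VS.

Fact arrangement_stable (w : W) (H : arrangement) :
  (complexify (val w) @: val H)%VS \in arrangement.
Proof.
case: w H => w Ww [H /= /imfsetP[s /=]]; rewrite inE /= => /andP[Ws rs] ->.
have w0 := finGLgroup_ker0 Ww; have cw0 := complexify_ker0 w0.
have s0 := finGLgroup_ker0 Ws; have cs0 := complexify_ker0 s0.
have Wt : (w \o s \o w^-1)%VF \in elts W.
  by rewrite !finGLgroupM ?finGLgroupV.
have t0 := finGLgroup_ker0 Wt.
have Et : complexify (w \o s \o w^-1)%VF =
    (complexify w \o complexify s \o (complexify w)^-1)%VF.
  by rewrite !complexify_comp complexify_inv.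
apply/imfsetP; exists (w \o s \o w^-1)%VF; last by rewrite /= Et fixedSpace_conj.
rewrite inE /= Wt /= /is_reflection complexify_ker0 //=.
rewrite Et fixedSpace_conj // limg_dim_eq; last first.
  by rewrite (eqP cw0) capv0.
by case/andP: rs.
Qed.

Definition hyp_act (w : W) (H : arrangement) : arrangement :=
  [` arrangement_stable w H].

Definition CA := {ffun arrangement -> C^o}.

Definition CA_basis (H : arrangement) : CA := [ffun H' => (H' == H)%:R].

(* The linear action with w . v_H = v_(w(H)). *)
Definition CA_act (w : W) (u : CA) : CA :=
  \sum_(H : arrangement) (u H : C) *: CA_basis (hyp_act w H).

Lemma CA_act_basis w H : CA_act w (CA_basis H) = CA_basis (hyp_act w H).
Proof.
rewrite /CA_act (bigD1 H) //= ffunE eqxx scale1r big1 ?addr0 // => H' neqH.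
by rewrite ffunE (negPf neqH) scale0r.
Qed.

(* S^2 V^* is the space of the functions x |-> B(x, x) with B bilinear. *)
Definition is_quadratic_form (q : V -> C^o) : Prop :=
  exists B : 'Hom(V, 'Hom(V, C^o)), forall x, q x = B x x.

Definition quadratic_form : {pred V -> C^o} :=
  fun q => `[< is_quadratic_form q >].

Fact quadratic_form_submod_closed : submod_closed quadratic_form.
Proof.
split=> [|a q r /asboolP[B qE] /asboolP[D rE]]; apply/asboolP.
  by exists 0 => x; rewrite !zero_lfunE.
exists (a *: B + D) => x.
rewrite add_lfunE add_lfunE scale_lfunE scale_lfunE -qE -rE.
by [].
Qed.

HB.instance Definition _ := GRing.isSubmodClosed.Build C (V -> C^o)
  quadratic_form quadratic_form_submod_closed.

Record S2dual := QuadraticForm {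
  qform_fun :> V -> C^o;
  qform_funP : qform_fun \in quadratic_form
}.

HB.instance Definition _ := [isSub for qform_fun].
HB.instance Definition _ := [Choice of S2dual by <:].
HB.instance Definition _ := [SubChoice_isSubLmodule of S2dual by <:].

Fact qform_act_subproof (w : W) (q : S2dual) :
  (fun x => q ((complexify (val w))^-1%VF x)) \in quadratic_form.
Proof.
have /asboolP[B qE] := qform_funP q; apply/asboolP.
set g := ((complexify _)^-1)%VF.
pose D (x : V) : 'Hom(V, C^o) := (B (g x) \o g)%VF.
have D_lin : linear D.
  move=> a x y; apply/lfunP=> z.
  by rewrite /D !linearP /= comp_lfunE !add_lfunE !scale_lfunE !comp_lfunE.
pose DM := GRing.isLinear.Build C V 'Hom(V, C^o) *:%R D D_lin.
pose DL : {linear V -> 'Hom(V, C^o)} := HB.pack D DM.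
by exists (linfun DL) => x; rewrite qE lfunE /= /D comp_lfunE.
Qed.

(* (w . q)(x) = q (w^-1 . x) *)
Definition qform_act (w : W) (q : S2dual) : S2dual :=
  QuadraticForm (qform_act_subproof w q).

Fact sqr_form_subproof (a : 'Hom(V, C^o)) :
  (fun x => a x ^+ 2 : C^o) \in quadratic_form.
Proof.
apply/asboolP.
pose D (x : V) : 'Hom(V, C^o) := (a x : C) *: a.
have D_lin : linear D.
  by move=> c x y; rewrite /D linearP /= scalerDl scalerA.
pose DM := GRing.isLinear.Build C V 'Hom(V, C^o) *:%R D D_lin.
pose DL : {linear V -> 'Hom(V, C^o)} := HB.pack D DM.
by exists (linfun DL) => x; rewrite lfunE /= /D scale_lfunE expr2.
Qed.

Definition sqr_form (a : 'Hom(V, C^o)) : S2dual :=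
  QuadraticForm (sqr_form_subproof a).

End ReflectionArrangement.

(* Main.v *)
Require Import Defs.
From HB Require Import structures.
From mathcomp Require Import all_boot all_order all_algebra finmap.
From mathcomp Require Import boolp functions reals.
From mathcomp Require Import complex.

Set Implicit Arguments.
Unset Strict Implicit.
Unset Printing Implicit Defensive.

Import Order.TTheory GRing.Theory Num.Theory.
Local Open Scope ring_scope.

(* Choose for every H a linear form b_H with kernel H which is real on V_0.
   For w in W the form b_(wH) o w has kernel H, so it is a real multiple of
   b_H. Hence q_H := sum_w (b_(wH) o w)^2 equals c_H b_H^2 for some real c_H,
   which is positive because of the term w = 1, and q_(gH) o g = q_H by
   reindexing the sum. Take alpha_H := sqrt(c_H) b_H. *)

(** By dimension, U is the direct sum of the line of [x0] and [H]; the form reads off the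
    coefficient along [x0]. *)
Lemma hyperplane_form (K : fieldType) (U : vectType K) (H : {vspace U}) x0 :
  (\dim H).+1 = \dim {:U} -> x0 \notin H ->
  exists2 f : 'Hom(U, K^o), lker f = H & f x0 = 1.
Proof.
move=> dimH x0H.
have x0N0 : x0 != 0 by apply: contraNneq x0H => ->; apply: mem0v.
have capH : (H :&: <[x0]> = 0)%VS.
  apply/eqP; rewrite -subv0; apply/subvP=> y; rewrite memv_cap.
  case/andP=> yH /vlineP[k yE]; rewrite memv0 yE.
  have [->|k0] := eqVneq k 0; first by rewrite scale0r.
  by rewrite yE rpredZeq (negPf k0) (negPf x0H) in yH.
have addH : (<[x0]> + H)%VS = {:U}%VS.
  apply/eqP; rewrite eqEdim subvf addvC dimv_disjoint_sum // dim_vline x0N0.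
  by rewrite addn1 dimH leqnn.
have capH' : (<[x0]> :&: H = 0)%VS by rewrite capvC.
pose p := daddv_pi <[x0]> H.
pose X := [tuple x0].
have spanX : <<X>>%VS = <[x0]>%VS by rewrite span_seq1.
(* The projection [p y] along [H] is a multiple of [x0]; its coordinate in the one-element free
   family [X] is the scalar. *)
pose g (y : U) : K^o := coord X 0 (p y).
have g_lin : linear g by move=> a y z; rewrite /g !linearP.
pose gM := GRing.isLinear.Build K U K^o *:%R g g_lin.
pose gL : {linear U -> K^o} := HB.pack g gM.
have gE y : linfun gL y = coord X 0 (p y) by rewrite lfunE.
have freeX : free X by rewrite seq1_free.
have pE y : p y = coord X 0 (p y) *: x0.
  have /coord_span : p y \in <<X>>%VS by rewrite spanX memv_pi.
  by rewrite big_ord1.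
exists (linfun gL); last first.
  by rewrite gE daddv_pi_id ?memv_line // (coord_free 0 0 freeX).
apply/vspaceP=> y; rewrite memv_ker gE.
have yE : p y + daddv_pi H <[x0]> y = y by rewrite daddv_pi_add // addH memvf.
apply/eqP/idP => [c0|yH].
  by rewrite -yE pE c0 scale0r add0r memv_pi.
have py : p y \in H.
  have -> : p y = y - daddv_pi H <[x0]> y by rewrite -{2}yE addrK.
  by rewrite memvB // memv_pi.
have -> : p y = 0; last by rewrite linear0.
by apply/eqP; rewrite -memv0 -capH' memv_cap py memv_pi.
Qed.

(** The vector x - f(x) x0 is killed by [f], hence by [g]. The explicit ratio [g x0] is what later
    makes the ratio real. *)
Lemma form_proportional (K : fieldType) (U : vectType K)
    (f g : 'Hom(U, K^o)) (x0 x : U) :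
  (lker f <= lker g)%VS -> f x0 = 1 -> g x = (g x0 : K) * f x.
Proof.
move=> fg fx0; have : x - (f x : K) *: x0 \in lker g.
  apply: (subvP fg); rewrite memv_ker linearB linearZ /= fx0.
  by rewrite /GRing.scale /= mulr1 subrr.
rewrite memv_ker linearB linearZ /= subr_eq0 => /eqP->.
by rewrite mulrC.
Qed.

Lemma lker_scale (K : fieldType) (U U' : vectType K) (a : K)
    (f : 'Hom(U, U')) :
  a != 0 -> lker (a *: f) = lker f.
Proof.
move=> a0; apply/vspaceP=> x.
by rewrite !memv_ker scale_lfunE scaler_eq0 (negPf a0).
Qed.

Section RealForms.
Variables (R : realType) (V0 : vectType R) (W : finGLgroup V0).
Local Notation C := R[i].
Local Notation V := (complexification V0).
Local Notation A := (arrangement W).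

Lemma arrangement_dim (H : A) : (\dim (val H)).+1 = \dim {:V}.
Proof.
case: H => H /= /imfsetP[s /=]; rewrite inE /= => /andP[_ /andP[_ /eqP rs]] ->.
exact: rs.
Qed.

(** A complexified map acts separately on real and imaginary parts, so its fixed space contains both
    parts of each of its vectors. *)
Lemma arrangement_mem (H : A) (x y : V0) :
  ((x, y) : V) \in val H =
  (((x, 0) : V) \in val H) && (((y, 0) : V) \in val H).
Proof.
case: H => H /= /imfsetP[s _ ->] /=.
have E u v : ((u, v) : V) \in fixedSpace (complexify s) = (s u == u) && (s v == v).
  apply/fixedSpaceP/andP; rewrite complexifyE /=.
    by move=> [/eqP-> /eqP->].
  by move=> [/eqP-> /eqP->].
by rewrite !E linear0 eqxx !andbT.
Qed.

Lemma arrangement_real_form (H : A) :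
  exists bx : 'Hom(V, C^o) * V0,
    [/\ lker bx.1 = val H, bx.1 (bx.2, 0) = 1 &
        forall y : V0, (bx.1 (y, 0) : C) \is Num.real].
Proof.
have [a aH] : exists a : V0, ((a, 0) : V) \notin val H.
  (* If all real vectors lay in [H], so would all their complex combinations, against the dimension
     of [H]. *)
  apply: contrapT => nex; have full : (fullv <= val H)%VS.
    apply/subvP=> -[x y] _; rewrite arrangement_mem.
    by apply/andP; split; apply: contrapT => /negP n; apply: nex;
      [exists x | exists y].
  by have := dimvS full; rewrite -(arrangement_dim H) ltnn.
have [f kerf fa] := hyperplane_form (arrangement_dim H) aH.
exists (f, a); split=> //= y.
(* With f(y) = u + iv, this vector of [H] has imaginary part -v a, which lies in [H] too; v nonzero
   would put [a] in [H]. *)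
have : ((y, 0) : V) - (f (y, 0) : C) *: ((a, 0) : V) \in lker f.
  by rewrite memv_ker linearB linearZ /= fa /GRing.scale /= mulr1 subrr.
case: (f (y, 0)) => u v; rewrite complex_real /=.
have -> : ((y, 0) : V) - (u +i* v)%C *: ((a, 0) : V) = (y - u *: a, - (v *: a)).
  by congr pair => /=; rewrite scaler0 ?subr0 ?add0r ?sub0r.
rewrite kerf arrangement_mem => /andP[_ vaH].
apply: contraNT aH => v0.
have -> : ((a, 0) : V) = ((- v^-1)%:C%C : C) *: ((- (v *: a), 0) : V).
  congr pair => /=; rewrite ?scaler0 ?scale0r ?subr0 ?addr0 //.
  by rewrite scaleNr scalerN opprK scalerA mulVf ?scale1r.
exact: memvZ.
Qed.

Definition elts_comp (w g : W) : W :=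
  [` finGLgroupM (valP w) (valP g)]%fset.

Definition elts_id : W := [` finGLgroup1 W]%fset.

(** Right translation by [g] will reindex sums over [W]. *)
Lemma elts_compI (g : W) : injective (elts_comp^~ g).
Proof.
move=> w w' /(congr1 val) /= E; apply: val_inj => /=.
have g0 := finGLgroup_ker0 (valP g).
apply/lfunP=> x; have := congr1 (fun h : 'End(V0) => h ((val g)^-1%VF x)) E.
by rewrite !comp_lfunE /= !lker0_lfunVK.
Qed.

Lemma hyp_act_comp (w g : W) (H : A) :
  hyp_act w (hyp_act g H) = hyp_act (elts_comp w g) H.
Proof. by apply: val_inj => /=; rewrite complexify_comp limg_comp. Qed.

Lemma hyp_act_id (H : A) : hyp_act elts_id H = H.
Proof.
apply: val_inj => /=; rewrite (_ : complexify \1 = \1%VF) ?lim1g //.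
by apply/lfunP=> -[x y]; rewrite complexifyE /= !id_lfunE.
Qed.

End RealForms.

Theorem proposition4p4 (R : realType) (V0 : vectType R) (W : finGLgroup V0)
    (W_refl : generated_by_reflections W) (W_ess : essential W) :
  exists alpha : arrangement W -> 'Hom(complexification V0, R[i]^o),
    (forall H : arrangement W, lker (alpha H) = val H) /\
    (exists Phi : {linear CA W -> S2dual V0},
      (forall H : arrangement W, Phi (CA_basis H) = sqr_form (alpha H)) /\
      (forall (w : W) (u : CA W), Phi (CA_act w u) = qform_act w (Phi u))).
Proof.
pose V := complexification V0.
have [bx bxP] := boolp.choice (@arrangement_real_form R V0 W).
pose b H := (bx H).1; pose x0 H : V := ((bx H).2, 0).
have kerb H : lker (b H) = val H by case: (bxP H).
have bx0 H : b H (x0 H) = 1 by case: (bxP H).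
(* The ratio of b_(wH) o w to b_H, evaluated at the real vector [x0 H] where b_H is 1; [w] keeps
   this vector real, so the ratio is real. *)
pose r (w : W) H : R[i] := b (hyp_act w H) (complexify (val w) (x0 H)).
have r_real w H : r w H \is Num.real.
  rewrite /r complexifyE /= linear0.
  by case: (bxP (hyp_act w H)).
have rE (w : W) H x : (b (hyp_act w H) (complexify (val w) x) : R[i])
    = r w H * b H x.
  pose g := (b (hyp_act w H) \o complexify (val w))%VF.
  have sub : (lker (b H) <= lker g)%VS.
    apply/subvP=> y; rewrite kerb memv_ker comp_lfunE => yH.
    by rewrite -memv_ker kerb /= memv_img.
  by have := form_proportional x sub (bx0 H); rewrite !comp_lfunE.
pose c H : R[i] := \sum_(w : W) r w H ^+ 2.
have c_gt0 H : 0 < c H.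
  rewrite /c (bigD1 (elts_id W)) //= ltr_pwDl //.
    rewrite /r hyp_act_id (_ : complexify _ (x0 H) = x0 H) ?bx0 ?expr1n //.
    by rewrite complexifyE /= !id_lfunE.
  (* Reality of the ratios matters here: squares of arbitrary complex numbers could cancel the term
     1 of the identity. *)
  by apply: sumr_ge0 => w _; rewrite real_exprn_even_ge0.
have cE H x : c H * b H x ^+ 2 =
    \sum_(w : W) (b (hyp_act w H) (complexify (val w) x) : R[i]) ^+ 2.
  by rewrite mulr_suml; apply: eq_bigr => w _; rewrite rE exprMn.
pose alpha H : 'Hom(V, R[i]^o) := sqrtC (c H) *: b H.
have alphaE H x : (alpha H x : R[i]) ^+ 2 = c H * (b H x : R[i]) ^+ 2.
  by rewrite scale_lfunE /GRing.scale /= exprMn sqrtCK.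
have alpha_act (g : W) H x :
    (alpha (hyp_act g H) (complexify (val g) x) : R[i]) ^+ 2
    = (alpha H x : R[i]) ^+ 2.
  (* Both sides become sums over [W] of squares of b_(wH) o w; replacing w by wg on the right
     matches them term by term. *)
  rewrite !alphaE !cE [RHS](reindex_inj (@elts_compI _ _ _ g)).
  apply: eq_bigr => w _.
  by rewrite hyp_act_comp /= complexify_comp comp_lfunE.
exists alpha; split=> [H|].
  (* Positivity of [c H] makes the scalar nonzero, so the kernel is still [H]. *)
  have sc0 : sqrtC (c H) != 0 by rewrite sqrtC_eq0 gt_eqF.
  by rewrite -(kerb H); exact: lker_scale.
pose Phi (u : CA W) : S2dual V0 :=
  \sum_(H : arrangement W) (u H : R[i]) *: sqr_form (alpha H).
have Phi_lin : linear Phi.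
  move=> a u v; rewrite /Phi scaler_sumr -big_split /=; apply: eq_bigr => H _.
  by rewrite !ffunE scalerDl scalerA.
pose PhiM := GRing.isLinear.Build R[i] (CA W) (S2dual V0) *:%R Phi Phi_lin.
pose PhiL : {linear CA W -> S2dual V0} := HB.pack Phi PhiM.
have Phi_basis H : PhiL (CA_basis H) = sqr_form (alpha H).
  rewrite /= /Phi (bigD1 H) //= ffunE eqxx scale1r big1 ?addr0 // => H' neqH.
  by rewrite ffunE (negPf neqH) scale0r.
exists PhiL; split=> // w u.
have w0 := complexify_ker0 (finGLgroup_ker0 (valP w)).
have PhiE : Phi (CA_act w u)
    = \sum_H (u H : R[i]) *: sqr_form (alpha (hyp_act w H)).
  have -> : Phi (CA_act w u) = PhiL (CA_act w u) by [].
  rewrite /CA_act linear_sum; apply: eq_bigr => H _.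
  by rewrite linearZ Phi_basis.
have sumE (F : arrangement W -> S2dual V0) y :
    (\sum_H (u H : R[i]) *: F H) y = \sum_H (u H : R[i]) * F H y.
  pose ev (q : S2dual V0) : R[i] := q y.
  exact: (big_morph ev (id1 := 0) (op1 := +%R)).
(* Compared at [x], the two sides agree termwise by [alpha_act] applied at the point w^-1 x. *)
apply: val_inj; apply/funext => x; rewrite /= PhiE /Phi !sumE.
apply: eq_bigr => H _; congr (_ * _).
by rewrite /= -[RHS](alpha_act w) lker0_lfunVK.
Qed.
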